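(* Let $a$ be an integer with $3\nmid a$. (i) If $a\ge 3$ is odd, $D$ is a DM$(3;a)$ in standard form, and $H$ is the matrix of Construction 1 on $D$, then the $(a^2,4,a)$-regular binary LDPC code with parity-check matrix $H$ has stopping distance at least $8$. (ii) If $a\ge 4$ is even, $D$ is a DCA$(3;a)$ in standard form, and $\overline H$ is the matrix of Construction 2 on $D$, then the $(a^2-a,4,\{a-1,a\})$-near regular binary LDPC code with parity-check matrix $\overline H$ has stopping distance at least $8$.
   Context: All rows and columns of matrices are indexed starting from $0$. Difference matrix: for odd $a$, a DM$(3;a)$ is an $a\times 3$ array $D=[D(i,j)]$, $0\le i\le a-1$, $0\le j\le 2$, with entries in $\{0,\dots,a-1\}$, such that all entries of the first column ($j=0$) are $0$, each other column contains each of $0,\dots,a-1$ exactly once, and for all pairs of distinct columns $j\ne j'$, $\{D(i,j)-D(i,j') \bmod a \mid 0\le i\le a-1\}=\{0,\dots,a-1\}$. Difference covering array: for even $a$, a DCA$(3;a)$ is an $a\times 3$ array $D=[D(i,j)]$ with entries in $\{0,\dots,a-1\}$ such that all entries of the first column ($j=0$) are $0$, each other column contains each of $0,\dots,a-1$ exactly once, and for the distinct non-zero columns $j\ne j'$ the differences $D(i,j)-D(i,j')\bmod a$, $0\le i\le a-1$, are all non-zero and cover $\{1,\dots,a-1\}$. (Then exactly two rows $r$ satisfy $D(r,2)-D(r,1)\equiv a/2\pmod a$.) Either kind of array is in standard form if $D(i,1)=i$ for all $i$. For such an array $D$ let $I$ be the $a\times a$ identity matrix, let $P^i$ be the $a\times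 a$ $(0,1)$ circulant permutation matrix whose row $r$ has its unique entry $1$ in column $r-i\bmod a$, for $0\le v\le a-1$ let $R_v$ be the $a\times a$ matrix whose row $v$ is all ones and whose other rows are all zeros, and set $$M(D)=\begin{bmatrix} R_0&R_1&\cdots&R_{a-1}\\ I&I&\cdots&I\\ P^{D(0,1)}&P^{D(1,1)}&\cdots&P^{D(a-1,1)}\\ P^{D(0,2)}&P^{D(1,2)}&\cdots&P^{D(a-1,2)}\end{bmatrix}.$$ Construction 1 ($a$ odd, $D$ a DM$(3;a)$): $H=M(D)$, a $(4a)\times a^2$ matrix. Construction 2 ($a$ even, $D$ a DCA$(3;a)$): let $r_0$ be one (either one) of the two rows with $D(r_0,2)-D(r_0,1)\equiv a/2\pmod a$; $\overline H$ is the $(4a-1)\times(a^2-a)$ matrix obtained from $M(D)$ by deleting the block of $a$ columns corresponding to $v=r_0$ and then the resulting all-zero row $r_0$. The code with a given binary parity-check matrix is its null space over $\mathbb{Z}_2$. Regular, respectively near regular, with the stated parameters means: number of columns equal to the first parameter, all column weights $4$, and all row weights equal to $a$, respectively in $\{a-1,a\}$. A stopping set of a binary parity-check matrix is a set $S$ of its columns such that in the submatrix formed by the columns of $S$ every row has integer row sum $0$ or at least $2$. The stopping distance of the code (with respect to this parity-check matrix, equivalently of its Tanner graph) is the size of the smallest non-empty stopping set. *)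

(* Defs.v *)
From mathcomp Require Import all_boot all_order all_algebra.

Set Implicit Arguments.
Unset Strict Implicit.
Unset Printing Implicit Defensive.

Import GRing.Theory.
Local Open Scope ring_scope.

(** * Difference matrices and difference covering arrays *)

Lemma ord_gt0 (a : nat) (x : 'I_a) : (0 < a)%N.
Proof. exact: leq_ltn_trans (leq0n x) (ltn_ord x). Qed.

(* [x - y mod a]; the subtraction [a - y] is exact since [y < a]. *)
Definition submod (a : nat) (x y : 'I_a) : 'I_a :=
  Ordinal (ltn_pmod (x + (a - y))%N (ord_gt0 x)).

Definition differences (a : nat) (D : 'M['I_a]_(a, 3)) (j j' : 'I_3) :
    {set 'I_a} :=
  [set submod (D i j) (D i j') | i : 'I_a].

Definition is_DM (a : nat) (D : 'M['I_a]_(a, 3)) : Prop :=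
  [/\ odd a,
      forall i : 'I_a, D i 0 = 0%N :> nat,
      forall j : 'I_3, j != 0 -> forall x : 'I_a, exists! i : 'I_a, D i j = x
    & forall j j' : 'I_3, j != j' -> differences D j j' = [set: 'I_a]].

Definition is_DCA (a : nat) (D : 'M['I_a]_(a, 3)) : Prop :=
  [/\ ~~ odd a,
      forall i : 'I_a, D i 0 = 0%N :> nat,
      forall j : 'I_3, j != 0 -> forall x : 'I_a, exists! i : 'I_a, D i j = x
    & forall j j' : 'I_3, j != 0 -> j' != 0 -> j != j' ->
        differences D j j' = [set d : 'I_a | (d : nat) != 0%N]].

Definition standard_form (a : nat) (D : 'M['I_a]_(a, 3)) : Prop :=
  forall i : 'I_a, D i 1 = i.

(** * The parity-check matrices *)

Definition one_row (a : nat) (v : 'I_a) : 'M['F_2]_a :=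
  \matrix_(r, c) (r == v)%:R.

Definition circulant (a : nat) (i : 'I_a) : 'M['F_2]_a :=
  \matrix_(r, c) (c == submod r i)%:R.

Definition block_column (a : nat) (D : 'M['I_a]_(a, 3)) (v : 'I_a) :
    'M['F_2]_(a + (a + (a + a)), a) :=
  col_mx (one_row v)
    (col_mx 1%:M (col_mx (circulant (D v 1)) (circulant (D v 2)))).

Definition Mmx (a : nat) (D : 'M['I_a]_(a, 3)) :
    'M['F_2]_(a + (a + (a + a)), \sum_(v < a) a) :=
  \mxrow_(v < a) block_column D v.

Definition construction1 (a : nat) (D : 'M['I_a]_(a, 3)) := Mmx D.

(* As [k] ranges over ['I_a.-1], [lift r0 k] enumerates, in increasing order,
   the block indices other than [r0]; [lshift _ r0] is row [r0] of the top
   block. *)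
Definition construction2 (a : nat) (D : 'M['I_a]_(a, 3)) (r0 : 'I_a) :
    'M['F_2]_((a + (a + (a + a))).-1, \sum_(k < a.-1) a) :=
  row' (lshift (a + (a + a)) r0)
    (\mxrow_(k < a.-1) submxrow (Mmx D) (lift r0 k)).

(** * Regularity and stopping distance *)

Definition row_weight (m n : nat) (H : 'M['F_2]_(m, n)) (i : 'I_m) : nat :=
  #|[set j | H i j != 0]|.

Definition col_weight (m n : nat) (H : 'M['F_2]_(m, n)) (j : 'I_n) : nat :=
  #|[set i | H i j != 0]|.

Definition regular (m n : nat) (H : 'M['F_2]_(m, n)) (N w r : nat) : Prop :=
  [/\ n = N,
      forall j : 'I_n, col_weight H j = w
    & forall i : 'I_m, row_weight H i = r].

Definition near_regular (m n : nat) (H : 'M['F_2]_(m, n))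
    (N w : nat) (rs : seq nat) : Prop :=
  [/\ n = N,
      forall j : 'I_n, col_weight H j = w
    & forall i : 'I_m, row_weight H i \in rs].

(* The entries, which lie in ['F_2], are added as natural numbers. *)
Definition stopping_set (m n : nat) (H : 'M['F_2]_(m, n)) (S : {set 'I_n}) :
    Prop :=
  forall i : 'I_m, let s := (\sum_(j in S) (H i j : nat))%N in
    s = 0%N \/ (2 <= s)%N.

Definition is_stopping_distance (m n : nat) (H : 'M['F_2]_(m, n)) (d : nat) :
    Prop :=
  (exists S : {set 'I_n}, [/\ S != set0, stopping_set H S & #|S| = d]) /\
  (forall S : {set 'I_n}, S != set0 -> stopping_set H S -> (d <= #|S|)%N).

(* Main.v *)
Require Import Defs.
From mathcomp Require Import all_boot all_order all_algebra.
From mathcomp Require Import zify.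

(** Write [phi v] for the entry [D v 2].  A column of the parity-check matrix is
    a block [(v, c)]: column [c] of the [v]-th block column.  Its four ones lie
    one in each of the four bands of rows, at the positions [v], [c], [c + v]
    and [c + phi v] modulo [a]; call these the coordinates of the block.  Since
    [phi] and [v |-> phi v - v] are injective on the indices [v] in use, two
    distinct blocks agree in at most one coordinate.  For even [a] the
    injectivity of [phi v - v] off [r0] comes from summing these differences:
    the total is 0, which forces the only repeated difference to be [a / 2].

    A stopping set is a set [S] of blocks such that, in each coordinate, every
    fibre (blocks of [S] sharing a given value) has at least two elements.  The
    fibres through a block meet only in it, so their sizes add up to at most
    [#|S| + 3] ([degree_le]).  This alone gives [#|S| >= 5], and excludes 5 and
    7: when [#|S|] is odd every coordinate has a fibre of size at least 3, which
    is too much for 5 blocks, and for 7 blocks it leaves one size-3 fibre in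
    each coordinate, whose intersection pattern is contradictory by a parity
    count ([card_neq7]).

    Six blocks are excluded by arithmetic, in the two possible shapes given by
    [card6_split].  Either some coordinate splits [S] into two fibres of size 3,
    of values [u] and [w]; then the other coordinates have equal sums over both
    halves, whence [3u = 3w], impossible as 3 is prime to [a] ([no_split]).  Or
    all fibres have size 2, and [S] is a 3 x 3 grid minus a transversal, with
    blocks [(v_i, c_j)], [i != j] ([punctured_grid]).  The pairing of the six
    cells by each of the last two coordinates has to exchange some cell [(i, j)]
    with its transpose and, unless it does so for all cells, this forces
    [2 c_i = 2 c_j] ([transposed_pair]).  The two coordinates exchange no common
    cell, so they give two different pairs [{i, j}], while the cyclic group has
    at most one element of order 2 ([no_grid]). *)

Set Implicit Arguments.
Unset Strict Implicit.
Unset Printing Implicit Defensive.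

Import GRing.Theory.

(** * Families of blocks with four coordinates *)

Lemma card_setI_sum (T : finType) (A B : {set T}) :
  #|A :&: B| = \sum_(q in A) (q \in B).
Proof.
rewrite -sum1_card big_mkcond [RHS]big_mkcond; apply: eq_bigr => q _.
by rewrite inE; case: (q \in A); case: (q \in B).
Qed.

Section Net.

Variables (T U : finType) (S : {set T}) (f : 'I_4 -> T -> U).

Definition fibre i u := [set q in S | f i q == u].

Lemma card_fibres i : #|S| = \sum_(u in f i @: S) #|fibre i u|.
Proof.
rewrite -sum1_card (partition_big_imset (f i)) /=.
by apply: eq_bigr => u _; rewrite -sum1_card; apply: eq_bigl => q; rewrite !inE.
Qed.

Hypothesis meet_once : forall i j p q, i != j -> p \in S -> q \in S ->
  f i p = f i q -> f j p = f j q -> p = q.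
Hypothesis fibre_ge2 : forall i p, p \in S -> 1 < #|fibre i (f i p)|.

Lemma fibre_gt1 i u : u \in f i @: S -> 1 < #|fibre i u|.
Proof. by case/imsetP=> p pS ->; apply: fibre_ge2. Qed.

Lemma fibre_inj i j u : i != j -> {in fibre j u &, injective (f i)}.
Proof.
move=> nij p q; rewrite !inE => /andP[pS /eqP pu] /andP[qS /eqP qu] e.
by apply: (meet_once nij) => //; rewrite pu qu.
Qed.

(** Every other block of [S] lies in at most one of the four fibres through
    [p]; the 3 accounts for [p] being counted four times. *)
Lemma degree_le p : p \in S -> \sum_(i < 4) #|fibre i (f i p)| <= #|S| + 3.
Proof.
move=> pS.
have E i : #|fibre i (f i p)| = 1 + \sum_(q in S :\ p) (f i q == f i p).
  rewrite (cardsD1 p) inE pS eqxx /= -sum1_card; congr (_ + _).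
  rewrite [RHS](bigID (fun q => f i q == f i p)) /= [X in _ + X]big1 ?addn0.
    by apply: eq_big => q; rewrite !inE ?andbA // => /andP[_ ->].
  by move=> q /andP[_ /negPf ->].
under eq_bigr do rewrite E.
rewrite big_split /= sum_nat_const card_ord muln1 exchange_big /=.
suff: \sum_(q in S :\ p) \sum_(i < 4) (f i q == f i p) <= \sum_(q in S :\ p) 1.
  by rewrite sum1_card (cardsD1 p S) pS [_ + 3]addnAC leq_add2l.
apply: leq_sum => q; rewrite inE in_set1 => /andP[nqp qS].
have [i /eqP ei|none] := pickP (fun i => f i q == f i p); last first.
  by rewrite big1 // => i _; rewrite none.
rewrite (bigD1 i) //= big1 ?addn0 ?leq_b1 // => j nji.
by case: eqP => // ej; case/eqP: nqp; apply: (meet_once nji).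
Qed.

(** Fibres of size 2 only would partition [S] into pairs. *)
Lemma fibre_gt2 i : odd #|S| -> exists2 u, u \in f i @: S & 2 < #|fibre i u|.
Proof.
move=> oS; apply/exists_inP; apply: contraLR oS.
rewrite negb_exists_in => /forall_inP no.
rewrite -dvdn2 (card_fibres i); apply: dvdn_sum => u uS.
by have := no u uS; have := fibre_gt1 uS; case: #|_| => [|[|[|]]].
Qed.

Lemma card_values_le i : 2 * #|f i @: S| <= #|S|.
Proof.
rewrite mulnC -sum_nat_const [leqRHS](card_fibres i).
by apply: leq_sum => u; apply: fibre_gt1.
Qed.

Lemma card_ge5 : S != set0 -> 4 < #|S|.
Proof.
case/set0Pn=> p pS; have := degree_le pS.
have: \sum_(i < 4) 2 <= \sum_(i < 4) #|fibre i (f i p)|.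
  by apply: leq_sum => i _; apply: fibre_ge2.
by rewrite sum_nat_const card_ord; lia.
Qed.

(** The other three fibres through [p] already contribute 2 each to
    [degree_le]. *)
Lemma large_fibre_degree i p : p \in S -> #|fibre i (f i p)| + 3 <= #|S|.
Proof.
move=> pS; have := degree_le pS; rewrite (bigD1 i) //=; set s := \sum_(j < 4 | _) _.
have: \sum_(j < 4 | j != i) 2 <= s.
  by apply: leq_sum => j _; apply: fibre_ge2.
by rewrite sum_nat_const cardC1 card_ord; lia.
Qed.

Lemma card_neq5 : #|S| != 5.
Proof.
apply/eqP=> S5; have [|u /imsetP[p pS ->]] := @fibre_gt2 ord0; first by rewrite S5.
by have := large_fibre_degree ord0 pS; rewrite S5; lia.
Qed.

(** Seven blocks would have in each coordinate [i] exactly three fibres, one of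
    them, [L i], of size 3.  For [j != i] the three elements of [L j] lie in
    distinct fibres of coordinate [i], hence meet each of them once.  Let [t q]
    be the number of sets [L j] that contain [q]; it is at most 2 by
    [degree_le].  Summed over [L i] it is 6, so it is 2 on every [L i], and 0
    elsewhere.  Summed over another fibre of coordinate [i] it is 3, which is
    odd. *)
Lemma card_neq7 : #|S| != 7.
Proof.
apply/eqP=> S7; have oS : odd #|S| by rewrite S7.
have /fin_all_exists[u Hu] (i : 'I_4) : exists u, u \in f i @: S /\ 2 < #|fibre i u|.
  by have [u] := fibre_gt2 i oS; exists u.
pose L i := fibre i (u i).
have LS i : L i \subset S by apply/subsetP=> q; rewrite inE => /andP[].
have sub i j : f i @: L j \subset f i @: S by apply: imsetS.
have k3 i : #|f i @: S| <= 3 by have := card_values_le i; rewrite S7; lia.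
have cardL i j : i != j -> #|f i @: L j| = #|L j|.
  by move=> nij; apply/card_in_imset/fibre_inj.
have L3 j : #|L j| = 3.
  have nij := neq_lift j ord0; rewrite eq_sym in nij.
  have := subset_leq_card (sub (lift j ord0) j).
  by rewrite cardL //; have := k3 (lift j ord0); have [_] := Hu j; rewrite -/(L j); lia.
have onto i j : i != j -> f i @: L j = f i @: S.
  by move=> nij; apply/eqP; rewrite eqEcard sub cardL // L3 k3.
have one i j x : i != j -> x \in f i @: S -> #|fibre i x :&: L j| = 1.
  move=> nij; rewrite -(onto i j) // => /imsetP[q qL ->].
  rewrite -(cards1 q); apply: eq_card => r; rewrite !inE.
  have qS := subsetP (LS j) _ qL.
  apply/idP/eqP => [/andP[/andP[rS /eqP e] rj]|->]; last first.
    by move: qL; rewrite inE => /andP[-> ->]; rewrite eqxx.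
  by apply: (fibre_inj nij (u := u j)) => //; rewrite inE rS (andP rj).2.
pose t q := \sum_(j < 4) (q \in L j).
have sumt i x : x \in f i @: S -> \sum_(q in fibre i x) t q = 3 + #|fibre i x :&: L i|.
  move=> xS; rewrite exchange_big (bigD1 i) //= addnC; congr (_ + _); last first.
    by rewrite card_setI_sum.
  transitivity (\sum_(j < 4 | j != i) 1); last first.
    by rewrite sum_nat_const cardC1 card_ord.
  apply: eq_bigr => j nji; rewrite -[RHS](one i j x) 1?eq_sym //.
  by rewrite card_setI_sum.
have t2 q : q \in S -> t q <= 2.
  move=> qS; have := degree_le qS.
  suff: \sum_(i < 4) (2 + (q \in L i)) <= \sum_(i < 4) #|fibre i (f i q)|.
    by rewrite big_split sum_nat_const card_ord S7 -/(t q) /=; lia.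
  apply: leq_sum => i _; have := fibre_ge2 i qS.
  case: (boolP (q \in L i)); last by rewrite addn0.
  by rewrite inE => /andP[_ /eqP ->] _; have [] := Hu i.
have tL i q : q \in L i -> t q = 2.
  move=> qL; have := sumt i (u i) (Hu i).1; rewrite -/(L i) setIid L3.
  rewrite (big_setD1 q) //=.
  have: \sum_(r in L i :\ q) t r <= \sum_(r in L i :\ q) 2.
    by apply: leq_sum => r /setD1P[_ rL]; apply/t2/(subsetP (LS i)).
  have := cardsD1 q (L i); rewrite qL L3 sum_nat_const.
  by have := t2 q (subsetP (LS i) _ qL); lia.
have teven q : 2 %| t q.
  have [i /tL -> //|none] := pickP (fun i => q \in L i).
  by rewrite /t big1 // => i _; rewrite none.
have [x xS nx] : exists2 x, x \in f ord0 @: S & x != u ord0.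
  have c3 : #|f ord0 @: S| = 3 by rewrite -(onto ord0 ord_max) // cardL // L3.
  have /card_gt0P[x] : 0 < #|f ord0 @: S :\ u ord0|.
    by have := cardsD1 (u ord0) (f ord0 @: S); rewrite c3; lia.
  by case/setD1P => ? ?; exists x.
have: 2 %| \sum_(q in fibre ord0 x) t q by apply: dvdn_sum.
rewrite sumt // (_ : _ :&: _ = set0) ?cards0 //.
apply/setP=> q; rewrite !inE; case: eqP => [->|]; last by rewrite andbF.
by rewrite (negPf nx) andbF andbF.
Qed.

(** By [large_fibre_degree] fibres have size 2 or 3.  The complement of a fibre of
    size 3 is too small to hold two fibres, so it is one as well, and any
    fibre of another coordinate takes exactly one block from each half. *)
Lemma card6_split : #|S| = 6 ->
  (forall i u, u \in f i @: S -> #|fibre i u| = 2) \/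
  exists i u w, [/\ u != w, #|fibre i u| = 3, #|fibre i w| = 3 &
    forall j x, j != i ->
      #|[set q in fibre i u | f j q == x]| = #|[set q in fibre i w | f j q == x]|].
Proof.
move=> S6.
have le3 i u : u \in f i @: S -> #|fibre i u| <= 3.
  by case/imsetP=> p pS ->; have := large_fibre_degree i pS; rewrite S6; lia.
have [/existsP[i /exists_inP[u uS /eqP u3]]|no] :=
  boolP [exists i, exists u in f i @: S, #|fibre i u| == 3]; last first.
  left=> i u uS; have := le3 i u uS; have := fibre_gt1 uS.
  have: #|fibre i u| != 3.
    by apply: contra no => u3; apply/existsP; exists i; apply/exists_inP; exists u.
  by case: #|_| => [|[|[|[|]]]].
right; exists i, u.
have c6 := card_fibres i; rewrite S6 (big_setD1 u) //= u3 in c6.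
have le1 : #|f i @: S :\ u| <= 1.
  have: \sum_(x in f i @: S :\ u) 2 <= \sum_(x in f i @: S :\ u) #|fibre i x|.
    by apply: leq_sum => x /setD1P[_]; apply: fibre_gt1.
  by rewrite sum_nat_const; lia.
have [w wE] : exists w, f i @: S :\ u = [set w].
  apply/cards1P; rewrite eqn_leq le1 /= lt0n; apply/eqP => /cards0_eq E.
  by move: c6; rewrite E big_set0.
have /setD1P[nwu wS] : w \in f i @: S :\ u by rewrite wE set11.
have w3 : #|fibre i w| = 3 by move: c6; rewrite wE big_set1; lia.
exists w; split=> //; first by rewrite eq_sym.
move=> j x nji.
have part z : #|[set q in fibre i z | f j q == x]| <= 1.
  apply/card_le1_eqP=> p q; rewrite !inE => /andP[/andP[pS pz] /eqP px].
  move=> /andP[/andP[qS qz] /eqP qx]; apply: (fibre_inj nji (u := z)).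
  - by rewrite inE qS.
  - by rewrite inE pS.
  - by rewrite px qx.
have E : fibre j x = [set q in fibre i u | f j q == x] :|: [set q in fibre i w | f j q == x].
  apply/setP=> q; rewrite !inE.
  case qS: (q \in S) => //=; case: (f j q == x); rewrite ?andbF //= !andbT.
  have : f i q \in f i @: S by apply: imset_f.
  rewrite -(setD1K uS) wE !inE => ->.
  done.
have [xS|xS] := boolP (x \in f j @: S); last first.
  have z0 z : #|[set q in fibre i z | f j q == x]| = 0.
    apply/eqP; rewrite cards_eq0; apply/eqP/setP=> q; rewrite !inE.
    apply: contraNF xS => /andP[/andP[qS _] /eqP <-]; exact: imset_f.
  by rewrite !z0.
have := fibre_gt1 xS; rewrite E cardsU.
have := part u; have := part w; lia.
Qed.

End Net.

Arguments fibre {T U} S f i u.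

Local Open Scope ring_scope.

(** * Pairing the cells of a punctured 3 x 3 grid *)

Lemma third_index (i j : 'I_3) : i != j ->
  exists k, [/\ k != i, k != j & forall x, [|| x == i, x == j | x == k]].
Proof.
move=> nij; have /card_gt0P[k] : (0 < #|~: [set i; j]|)%N.
  by have := cardsC [set i; j]; rewrite cards2 nij card_ord; lia.
rewrite !inE negb_or => /andP[ki kj]; exists k; split=> // x.
have /eqP/setP/(_ x) : [set i; j; k] == [set: 'I_3].
  rewrite eqEcard subsetT cardsT card_ord -setUA !cardsU1 cards1 !inE negb_or.
  by rewrite nij eq_sym ki eq_sym kj.
by rewrite !inE -orbA.
Qed.

Section Transposition.

Variables (G : zmodType) (p c : 'I_3 -> G).
Hypotheses (p_inj : injective p) (c_inj : injective c).

Local Notation g i j := (p i + c j).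

(** Together, [mate] and [mate_unique] say that [g] takes each of its values
    exactly twice on the off-diagonal cells. *)
Hypothesis mate : forall i j, i != j ->
  exists k l, [/\ k != l, (k, l) != (i, j) & g k l = g i j].
Hypothesis mate_unique : forall x y z : 'I_3 * 'I_3,
  x.1 != x.2 -> y.1 != y.2 -> z.1 != z.2 ->
  g x.1 x.2 = g y.1 y.2 -> g x.1 x.2 = g z.1 z.2 -> [|| x == y, x == z | y == z].

(** The mate of a cell lies neither in its row nor in its column. *)
Lemma mate_cases i j k : i != j -> k != i -> k != j ->
    (forall x, [|| x == i, x == j | x == k]) ->
  [\/ g i j = g j i, g i j = g j k | g i j = g k i].
Proof.
move=> nij ki kj all; have [k' [l' [nkl ne e]]] := mate nij.
have nk : k' != i.
  by apply: contraNneq ne => k'i; move: e; rewrite k'i => /addrI/c_inj ->.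
have nl : l' != j.
  by apply: contraNneq ne => l'j; move: e; rewrite l'j => /addIr/p_inj ->.
have := all k'; have := all l'; rewrite (negPf nk) (negPf nl) /=.
case/orP=> /eqP El; case/orP=> /eqP Ek; subst k' l'.
- by constructor 1.
- by constructor 3.
- by constructor 2.
- by rewrite eqxx in nkl.
Qed.

(** The six cells form two cyclic triples, [(0,1), (1,2), (2,0)] and its
    transpose; by [mate_cases], a cell is mated to its transpose or within its
    own triple.  As 3 is odd, some cell [(i, k)] is mated to its transpose.
    Either this holds of all cells, or, with [j] the third index, [(i, j)] is
    mated to [(j, k)] and [(j, i)] to [(k, j)], and adding up the three
    equalities gives [2 c_i = 2 c_k]. *)
Lemma transposed_pair : exists i j, [/\ i != j, g i j = g j i &
  c i *+ 2 = c j *+ 2 \/ forall k l, g k l = g l k].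
Proof.
(* If two cells of a cyclic triple are mates, the third is left to be mated to
   its transpose. *)
have step i j k : i != j -> k != i -> k != j ->
    (forall x, [|| x == i, x == j | x == k]) -> g i j = g j k -> g k i = g i k.
  move=> nij ki kj all e; have [nji ik jk] : [/\ j != i, i != k & j != k].
    by split; rewrite eq_sym.
  have nE := (negPf nij, negPf ki, negPf kj, negPf nji, negPf ik, negPf jk).
  have := @mate_unique (i, j) (j, k) (k, i) nij jk ki e.
  rewrite /= !xpair_eqE !nE andbF /= => no3.
  have all' x : [|| x == k, x == i | x == j].
    by case/or3P: (all x) => ->; rewrite ?orbT.
  have [//|e'|e'] := mate_cases ki jk nji all'.
    by have := no3 (esym e').
  by have := no3 (etrans e (esym e')).
have [i [k [nik e]]] : exists i k, i != k /\ g i k = g k i.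
  have nij : (0 : 'I_3) != 1 by [].
  have [k [ki kj all]] := third_index nij.
  have [e|e|e] := mate_cases nij ki kj all; first by exists 0, 1.
    by exists k, 0; rewrite (step _ _ _ nij ki kj all e).
  exists 1, k; rewrite eq_sym; split=> //; apply: (step k 0 1) => //.
    by rewrite eq_sym.
  by move=> x; case/or3P: (all x) => ->; rewrite ?orbT.
have [j [ji jk all]] := third_index nik.
have [nij kj ki] : [/\ i != j, k != j & k != i].
  by split; rewrite eq_sym.
have nE := (negPf nij, negPf ki, negPf kj, negPf ji, negPf nik, negPf jk).
have no3 a b := @mate_unique (i, k) (k, i) (a, b) nik ki.
have all' : forall x, [|| x == i, x == j | x == k].
  by move=> x; case/or3P: (all x) => ->; rewrite ?orbT.
have all'' : forall x, [|| x == j, x == k | x == i].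
  by move=> x; case/or3P: (all x) => ->; rewrite ?orbT.
have all3 : forall x, [|| x == j, x == i | x == k].
  by move=> x; case/or3P: (all x) => ->; rewrite ?orbT.
exists i, k; split=> //.
have [e1|e1|e1] := mate_cases nij ki kj all'; last first.
- have := no3 i j nij e; rewrite /= !xpair_eqE !nE ?andbF /= => no.
  by have := no (etrans e (esym e1)).
- left.
  have [e2|e2|e2] := mate_cases ji kj ki all3.
  + have := @mate_unique (i, j) (j, k) (j, i) nij jk ji e1 (esym e2).
    by rewrite /= !xpair_eqE !nE ?andbF.
  + by have := no3 j i ji e (esym e2); rewrite /= !xpair_eqE !nE ?andbF.
  have d : p i + c i = p k + c k.
    apply: (@addIr _ (p j + c j)).
    rewrite addrACA [c i + _]addrC addrACA e1 e2.
    by rewrite addrC addrACA [c j + _]addrC addrACA.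
  apply: (@addrI _ (p i + c k)); rewrite !mulr2n addrACA d [c k + c i]addrC.
  by rewrite addrACA -e.
right=> a b.
have e2 : g j k = g k j.
  have [//|e2|e2] := mate_cases jk nij nik all''.
  + by have := no3 j k jk e (etrans e (esym e2)); rewrite /= !xpair_eqE !nE ?andbF.
  + have := @mate_unique (i, j) (j, i) (j, k) nij ji jk e1 (esym e2).
    by rewrite /= !xpair_eqE !nE ?andbF.
by have /or3P[] := all a => /eqP ->; have /or3P[] := all b => /eqP ->.
Qed.

End Transposition.

(** * Blocks over an abelian group *)

Section Blocks.

Variables (G : finZmodType) (phi : G -> G).

Definition coordinate (i : 'I_4) (p : G * G) : G :=
  nth 0 [:: p.1; p.2; p.2 + p.1; p.2 + phi p.1] i.

(** The sum only depends on how many times each value is taken. *)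
Lemma split_sum (S : {set G * G}) (i j : 'I_4) (u w : G) (h : G -> G) :
  (forall x, #|[set q in fibre S coordinate i u | coordinate j q == x]|
     = #|[set q in fibre S coordinate i w | coordinate j q == x]|) ->
  \sum_(p in fibre S coordinate i u) h (coordinate j p) =
  \sum_(p in fibre S coordinate i w) h (coordinate j p).
Proof.
move=> E; have sumE A : \sum_(p in A) h (coordinate j p)
    = \sum_x h x *+ #|[set q in A | coordinate j q == x]|.
  rewrite (partition_big (coordinate j) xpredT) //=; apply: eq_bigr => x _.
  under eq_bigr => p /andP[_ /eqP ->] do over.
  by rewrite sumr_const; congr (_ *+ _); apply: eq_card => q; rewrite !inE.
by rewrite !sumE; apply: eq_bigr => x _; rewrite E.
Qed.

Hypothesis torsion3 : forall x : G, x *+ 3 = 0 -> x = 0.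

(** All coordinates but [i] have equal sums over the two halves.  The relations
    [x2 = x1 + x0] and [x3 = x1 + phi x0] between the coordinates then give the
    same for coordinate [i], for which the two sums are [3u] and [3w]. *)
Lemma no_split (S : {set G * G}) i u w :
  u != w -> #|fibre S coordinate i u| = 3%N -> #|fibre S coordinate i w| = 3%N ->
  ~ (forall j x, j != i -> #|[set q in fibre S coordinate i u | coordinate j q == x]|
                         = #|[set q in fibre S coordinate i w | coordinate j q == x]|).
Proof.
move=> nuw u3 w3 E.
pose sm j z := \sum_(p in fibre S coordinate i z) coordinate j p.
have smE j : j != i -> sm j u = sm j w.
  by move=> nji; apply: (split_sum id) => x; apply: E.
have phiE : i != 0 -> \sum_(p in fibre S coordinate i u) phi p.1
                    = \sum_(p in fibre S coordinate i w) phi p.1.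
  by move=> ni; apply: (@split_sum S i 0 u w phi) => x; apply: E; rewrite eq_sym.
have const z : #|fibre S coordinate i z| = 3%N -> sm i z = z *+ 3.
  move=> z3; rewrite -z3 -sumr_const; apply: eq_bigr => p.
  by rewrite inE => /andP[_ /eqP].
have add z : sm (inord 2) z = sm (inord 1) z + sm (inord 0) z.
  by rewrite -big_split; apply: eq_bigr => p _; rewrite /coordinate !inordK.
have addphi z : sm (inord 3) z = sm (inord 1) z + \sum_(p in fibre S coordinate i z) phi p.1.
  by rewrite -big_split; apply: eq_bigr => p _; rewrite /coordinate !inordK.
suff e : sm i u = sm i w.
  case/eqP: nuw; apply/eqP; rewrite -subr_eq0; apply/eqP/torsion3.
  by rewrite mulrnBl -(const u) // -(const w) // e subrr.
have ni k : i != inord k -> sm (inord k) u = sm (inord k) w.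
  by move=> nik; apply: smE; rewrite eq_sym.
have iE : i = inord i by rewrite inord_val.
case: (i) iE ni add addphi phiE => [[|[|[|[|k]]]] //= lt] -> ni add addphi phiE.
- have := add u; rewrite (ni 2%N) ?(ni 1%N) ?add; try by rewrite -val_eqE /= !inordK.
  by move/addrI.
- have := add u; rewrite (ni 2%N) ?(ni 0%N) ?add; try by rewrite -val_eqE /= !inordK.
  by move/addIr.
- by rewrite !add (ni 1%N) ?(ni 0%N) //; rewrite -val_eqE /= !inordK.
- rewrite !addphi (ni 1%N) ?phiE //; by rewrite -val_eqE /= !inordK.
Qed.

(** Each of the first two coordinates takes three values, so [S] lies in a 3 x 3
    grid [Q].  As [S] has two cells on each line of [Q], its complement [Z] has
    one; numbering the three cells of [Z] numbers rows and columns. *)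
Lemma punctured_grid (S : {set G * G}) : #|S| = 6%N ->
  (forall i u, u \in coordinate i @: S -> #|fibre S coordinate i u| = 2%N) ->
  exists v c : 'I_3 -> G, [/\ injective v, injective c &
    forall p, p \in S <-> exists i j, i != j /\ p = (v i, c j)].
Proof.
move=> S6 S2.
have k3 i : #|coordinate i @: S| = 3%N.
  have := card_fibres S coordinate i; rewrite S6.
  rewrite (eq_bigr (fun=> 2%N)) ?sum_nat_const; last by move=> u; apply: S2.
  by move: #|_| => k; lia.
pose i0 : 'I_4 := inord 0; pose i1 : 'I_4 := inord 1.
have c0 p : coordinate i0 p = p.1 by rewrite /coordinate inordK.
have c1 p : coordinate i1 p = p.2 by rewrite /coordinate inordK.
pose Q := setX (coordinate i0 @: S) (coordinate i1 @: S).
have SQ : S \subset Q.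
  by apply/subsetP=> p pS; rewrite inE -c0 -c1 !imset_f.
pose Z := Q :\: S.
have Z3 : #|Z| = 3%N by rewrite cardsD (setIidPr SQ) cardsX !k3 S6.
have Zfst : {in Z &, injective fst}.
  move=> [a b] [a' b'] /= /setDP[/setXP[/= aR bC] abS] /setDP[/setXP[/= _ bC'] abS'] e.
  rewrite -e in abS' *; congr (_, _); apply/eqP; apply: contraT => nb.
  have: (#|fibre S coordinate i0 a| <= #|[set (a, y) | y in coordinate i1 @: S :\ b :\ b']|)%N.
    apply/subset_leq_card/subsetP=> -[x y]; rewrite inE c0 /= => /andP[xyS /eqP xa].
    rewrite xa in xyS *; apply/imsetP; exists y => //; rewrite !in_setD1.
    have := imset_f (coordinate i1) xyS; rewrite c1 => ->; rewrite andbT.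
    by apply/andP; split; apply: contraTneq xyS => ->.
  rewrite (S2 _ _ aR) card_imset; last by move=> y y' [].
  have := cardsD1 b (coordinate i1 @: S); have := cardsD1 b' (coordinate i1 @: S :\ b).
  by rewrite bC k3 in_setD1 bC' eq_sym nb; lia.
have Zsnd : {in Z &, injective snd}.
  move=> [a b] [a' b'] /= /setDP[/setXP[/= aR bC] abS] /setDP[/setXP[/= aR' _] abS'] e.
  rewrite -e in abS' *; congr (_, _); apply/eqP; apply: contraT => na.
  have: (#|fibre S coordinate i1 b| <= #|[set (x, b) | x in coordinate i0 @: S :\ a :\ a']|)%N.
    apply/subset_leq_card/subsetP=> -[x y]; rewrite inE c1 /= => /andP[xyS /eqP yb].
    rewrite yb in xyS *; apply/imsetP; exists x => //; rewrite !in_setD1.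
    have := imset_f (coordinate i0) xyS; rewrite c0 => ->; rewrite andbT.
    by apply/andP; split; apply: contraTneq xyS => ->.
  rewrite (S2 _ _ bC) card_imset; last by move=> x x' [].
  have := cardsD1 a (coordinate i0 @: S); have := cardsD1 a' (coordinate i0 @: S :\ a).
  by rewrite aR k3 in_setD1 aR' eq_sym na; lia.
pose z (k : 'I_3) := enum_val (cast_ord (esym Z3) k).
have zZ k : z k \in Z by apply: enum_valP.
have zI : injective z by move=> k l /enum_val_inj/cast_ord_inj.
have vI : injective (fst \o z) by move=> k l /Zfst/zI; apply.
have cI : injective (snd \o z) by move=> k l /Zsnd/zI; apply.
have zonto (h : G * G -> G) i (hI : injective (h \o z)) x :
    {subset Z <= [pred p | h p \in coordinate i @: S]} ->
    x \in coordinate i @: S -> exists k, x = h (z k).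
  move=> hZ xS; have : x \in [set h (z k) | k : 'I_3].
    suff /eqP -> : [set h (z k) | k : 'I_3] == coordinate i @: S by [].
    rewrite eqEcard k3 card_imset // card_ord andbT.
    by apply/subsetP=> _ /imsetP[k _ ->]; apply: (hZ (z k)).
  by case/imsetP=> k _ ->; exists k.
exists (fst \o z), (snd \o z); split=> // p; split=> [pS|[i [j [nij ->]]]].
  have [i pi] : exists i, p.1 = fst (z i).
    apply: (zonto fst i0) => //; last by rewrite -c0 imset_f.
    by move=> q; rewrite !inE -c0 -c1 => /and3P[].
  have [j pj] : exists j, p.2 = snd (z j).
    apply: (zonto snd i1) => //; last by rewrite -c1 imset_f.
    by move=> q; rewrite !inE -c0 -c1 => /and3P[].
  exists i, j; split; last by rewrite [LHS]surjective_pairing pi pj.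
  apply/eqP=> e; have /setDP[_ /negP[]] := zZ i.
  by rewrite (surjective_pairing (z i)) -pi e -pj -surjective_pairing.
apply: contraT => nS; case/eqP: nij.
have yZ : (fst (z i), snd (z j)) \in Z.
  apply/setDP; split=> //; apply/setXP => /=.
  by have := zZ i; have := zZ j; rewrite !inE => /and3P[_ _ ->] /and3P[_ -> _].
have ei := Zfst _ _ yZ (zZ i) erefl; have ej := Zsnd _ _ yZ (zZ j) erefl.
by apply: zI; rewrite -ei.
Qed.

Section SmallFamily.

Variable S : {set G * G}.
Hypothesis meet_once : forall i j p q, i != j -> p \in S -> q \in S ->
  coordinate i p = coordinate i q -> coordinate j p = coordinate j q -> p = q.

Section Grid.

Variables v c : 'I_3 -> G.
Hypotheses (v_inj : injective v) (c_inj : injective c).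
Hypothesis gridS : forall p, p \in S <-> exists i j, i != j /\ p = (v i, c j).

Lemma gridP i j : i != j -> (v i, c j) \in S.
Proof. by move=> nij; apply/gridS; exists i, j. Qed.

(** Coordinate [n] separates the cells of a row and, being distinct from the
    second one, those of a column; [transposed_pair] applies. *)
Lemma grid_transposed n (p : 'I_3 -> G) : n != inord 1 ->
  (forall u, u \in coordinate n @: S -> #|fibre S coordinate n u| = 2%N) ->
  (forall i j, coordinate n (v i, c j) = p i + c j) ->
  exists i j, [/\ i != j, p i + c j = p j + c i &
    c i *+ 2 = c j *+ 2 \/ forall k l, p k + c l = p l + c k].
Proof.
move=> n1 S2 pE.
have cell_inj (x y : 'I_3 * 'I_3) : (v x.1, c x.2) = (v y.1, c y.2) -> x = y.
  by case: x y => [x1 x2] [y1 y2] /= [/v_inj -> /c_inj ->].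
apply: transposed_pair => // [i j e|i j nij|x y z nx ny nz exy exz].
- apply/eqP; apply: contraT => nij; have [k [ki kj _]] := third_index nij.
  suff [/v_inj eij] : (v i, c k) = (v j, c k) by rewrite eij eqxx in nij.
  apply: (meet_once n1); rewrite ?pE ?e //; try by rewrite gridP // eq_sym.
  by rewrite /coordinate inordK.
- have u2 := S2 _ (imset_f (coordinate n) (gridP nij)).
  have := cardsD1 (v i, c j) (fibre S coordinate n (coordinate n (v i, c j))).
  rewrite u2 inE gridP // eqxx add1n => -[/esym rest1].
  have /card_gt0P[q] : (0 < #|fibre S coordinate n (coordinate n (v i, c j)) :\ (v i, c j)|)%N.
    by rewrite rest1.
  rewrite in_setD1 inE => /and3P[nq /gridS[k [l [nkl qE]]] /eqP e].
  exists k, l; split=> //; last by rewrite -!pE -qE.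
  by apply: contraNneq nq => -[ki lj]; rewrite qE ki lj.
have u2 := S2 _ (imset_f (coordinate n) (gridP nx)).
apply: contraT; rewrite !negb_or => /and3P[nxy nxz nyz].
pose W := [set (v w.1, c w.2) | w in [set x; y; z]].
have WF : W \subset fibre S coordinate n (coordinate n (v x.1, c x.2)).
  apply/subsetP=> _ /imsetP[w w3 ->]; move: w3.
  rewrite !inE -orbA !pE => w3.
  by case/or3P: w3 => /eqP ->; rewrite gridP //= ?eqxx ?(esym exy) ?(esym exz) ?eqxx.
have := subset_leq_card WF; rewrite u2 card_imset; last exact: cell_inj.
by rewrite -setUA !cardsU1 cards1 !inE negb_or nxy nxz nyz.
Qed.

End Grid.

Hypothesis torsion2 : forall x y : G,
  x != 0 -> y != 0 -> x *+ 2 = 0 -> y *+ 2 = 0 -> x = y.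

(** The last two coordinates cannot both identify a cell with its transpose.
    Hence neither does so for all cells, and they yield two different pairs of
    indices with [2 c_i = 2 c_j].  Both differences [c_i - c_j] are then the
    unique element of order 2, which is unchanged by sign, and comparing
    them identifies the two pairs: contradiction. *)
Lemma no_grid : #|S| = 6%N ->
  ~ (forall i u, u \in coordinate i @: S -> #|fibre S coordinate i u| = 2%N).
Proof.
move=> S6 S2; have [v [c [v_inj c_inj gridS]]] := punctured_grid S6 S2.
have E2 i j : coordinate (inord 2) (v i, c j) = v i + c j.
  by rewrite /coordinate inordK //= addrC.
have E3 i j : coordinate (inord 3) (v i, c j) = phi (v i) + c j.
  by rewrite /coordinate inordK //= addrC.
have n21 : inord 2 != inord 1 :> 'I_4 by rewrite -val_eqE /= !inordK.
have n31 : inord 3 != inord 1 :> 'I_4 by rewrite -val_eqE /= !inordK.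
have n23 : inord 2 != inord 3 :> 'I_4 by rewrite -val_eqE /= !inordK.
have [i [j [nij eij tij]]] :=
  grid_transposed v_inj c_inj gridS n21 (S2 _) E2.
have [k [l [nkl ekl tkl]]] :=
  grid_transposed v_inj c_inj gridS n31 (S2 _) E3.
have apart x y : x != y -> v x + c y = v y + c x ->
    phi (v x) + c y != phi (v y) + c x.
  move=> nxy e2; apply/eqP=> e3.
  suff [/v_inj e] : (v x, c y) = (v y, c x) by rewrite e eqxx in nxy.
  apply: (meet_once n23); rewrite ?(gridP gridS) ?E2 ?E3 //.
  by rewrite eq_sym.
case: tij => [tij|all2]; last by have := apart _ _ nkl (all2 _ _); rewrite ekl eqxx.
case: tkl => [tkl|all3]; last by have := apart _ _ nij eij; rewrite all3 eqxx.
have tors x y x' y' : x != y -> x' != y' -> c x *+ 2 = c y *+ 2 ->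
    c x' *+ 2 = c y' *+ 2 -> c x - c y = c x' - c y'.
  move=> nxy nxy' e e'; apply: torsion2; rewrite ?subr_eq0 ?(inj_eq c_inj) //.
    by rewrite mulrnBl e subrr.
  by rewrite mulrnBl e' subrr.
have nji : j != i by rewrite eq_sym.
have nlk : l != k by rewrite eq_sym.
have same : (k == i) && (l == j) || (k == j) && (l == i).
  have [m [_ _ all]] := third_index nij.
  have eik : k = i -> l = j.
    move=> ki; have := tors _ _ _ _ nij nkl tij tkl.
    by rewrite ki => /addrI/oppr_inj/c_inj ->.
  have eil : l = i -> k = j.
    move=> li; have := tors _ _ _ _ nij nlk tij (esym tkl).
    by rewrite li => /addrI/oppr_inj/c_inj ->.
  have ejk : k = j -> l = i.
    move=> kj; have := tors _ _ _ _ nji nkl (esym tij) tkl.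
    by rewrite kj => /addrI/oppr_inj/c_inj ->.
  have ejl : l = j -> k = i.
    move=> lj; have := tors _ _ _ _ nji nlk (esym tij) (esym tkl).
    by rewrite lj => /addrI/oppr_inj/c_inj ->.
  case/or3P: (all k) => /eqP Ek.
  - by rewrite (eik Ek) Ek !eqxx.
  - by rewrite (ejk Ek) Ek !eqxx orbT.
  case/or3P: (all l) => /eqP El.
  - by rewrite (eil El) El !eqxx orbT.
  - by rewrite (ejl El) El !eqxx.
  by rewrite Ek El eqxx in nkl.
case/orP: same => /andP[/eqP Ek /eqP El]; rewrite {}Ek {}El in ekl.
  by have := apart _ _ nij eij; rewrite ekl eqxx.
by have := apart _ _ nij eij; rewrite ekl eqxx.
Qed.

Lemma card_ge8 : S != set0 ->
  (forall i p, p \in S -> (1 < #|fibre S coordinate i (coordinate i p)|)%N) ->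
  (8 <= #|S|)%N.
Proof.
move=> S0 ge2; have := card_ge5 meet_once ge2 S0.
have := card_neq5 meet_once ge2; have := card_neq7 meet_once ge2.
suff: #|S| != 6%N by case: #|S| => [|[|[|[|[|[|[|[|]]]]]]]].
apply/eqP=> S6; have [all2|[i [u [w [nuw u3 w3 E]]]]] := card6_split meet_once ge2 S6.
  exact: (no_grid S6 all2).
exact: (no_split nuw u3 w3 E).
Qed.

End SmallFamily.

Lemma coordinate_meet_once (V : {set G}) :
  {in V &, injective phi} -> {in V &, injective (fun x => phi x - x)} ->
  forall i j p q, i != j -> p.1 \in V -> q.1 \in V ->
    coordinate i p = coordinate i q -> coordinate j p = coordinate j q -> p = q.
Proof.
move=> phiI difI.
suff lt (i j : 'I_4) (p q : G * G) : (i < j)%N -> p.1 \in V -> q.1 \in V ->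
    coordinate i p = coordinate i q -> coordinate j p = coordinate j q -> p = q.
  move=> i j p q; rewrite -val_eqE neq_ltn => /orP[/lt|/lt H pV qV ei ej]; first exact.
  exact: H.
case: p q => [v c] [v' c'].
case: i j => [[|[|[|[|i]]]] //= hi] [[|[|[|[|j]]]] //= hj] _; rewrite /coordinate /= => vV vV'.
- by move=> -> ->.
- by move=> -> /addIr ->.
- by move=> -> /addIr ->.
- by move=> -> /addrI ->.
- by move=> -> /addrI/phiI ->.
move=> e2 e3; have e : v = v'.
  apply: difI => //=; rewrite -(addrKA c) [phi v + c]addrC e3 e2.
  by rewrite [c' + phi v']addrC addrKA.
by move: e2; rewrite e => /addIr ->.
Qed.

End Blocks.

(** * Incidence matrices *)

Lemma stopping_distance_exists m n (H : 'M['F_2]_(m, n)) (S : {set 'I_n}) :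
  S != set0 -> stopping_set H S -> exists d, is_stopping_distance H d.
Proof.
move=> S0 SS; pose weight (X : {set 'I_n}) i := (\sum_(j in X) (H i j : nat))%N.
pose stop X := [forall i, (weight X i == 0%N) || (1 < weight X i)%N].
have stopP X : reflect (stopping_set H X) (stop X).
  apply: (iffP forallP) => st i; have := st i.
    by case/orP=> [/eqP|]; [left | right].
  by rewrite /weight => -[->|->]; rewrite ?eqxx ?orbT.
pose Q d := [exists X : {set 'I_n}, [&& X != set0, stop X & #|X| == d]].
have exQ : exists d, Q d.
  by exists #|S|; apply/existsP; exists S; rewrite S0 eqxx andbT; apply/stopP.
case: (ex_minnP exQ) => d /existsP[X /and3P[X0 /stopP XS /eqP Xd]] dmin.
exists d; split; first by exists X.
by move=> Y Y0 /stopP YS; apply: dmin; apply/existsP; exists Y; rewrite Y0 YS eqxx.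
Qed.

(** Both constructions are incidence matrices: columns are the blocks [(v, c)]
    with [v] in [V], rows are the points [(i, u)], and a block lies on [(i, u)]
    when its coordinate [i] is [u].  The points [(0, u)] with [u] outside [V] lie
    on no block and have no row. *)
Section Incidence.

Variables (G : finZmodType) (phi : G -> G) (V : {set G}).
Variables (m n : nat) (H : 'M['F_2]_(m, n)).
Variables (block : 'I_n -> G * G) (point : 'I_m -> 'I_4 * G).

Hypotheses (block_inj : injective block) (point_inj : injective point).
Hypothesis blockP : forall p, reflect (exists j, block j = p) (p.1 \in V).
Hypothesis pointP : forall x,
  reflect (exists r, point r = x) ((x.1 == ord0) ==> (x.2 \in V)).
Hypothesis entryE : forall r j,
  H r j = (coordinate phi (point r).1 (block j) == (point r).2)%:R.

Lemma entry_nat r j :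
  (H r j : nat) = (coordinate phi (point r).1 (block j) == (point r).2).
Proof. by rewrite entryE; case: (_ == _). Qed.

Lemma entry_neq0 r j :
  (H r j != 0) = (coordinate phi (point r).1 (block j) == (point r).2).
Proof. by rewrite entryE; case: (coordinate _ _ _ == _). Qed.

Lemma incidence_cols : n = (#|V| * #|G|)%N.
Proof.
have -> : n = #|block @: [set: 'I_n]| by rewrite card_imset // cardsT card_ord.
rewrite -[#|G|]cardsT -cardsX; apply: eq_card => p; rewrite [RHS]inE in_setT andbT.
apply/imsetP/blockP => [[j _ ->]|[j <-]]; by exists j.
Qed.

Lemma incidence_col_weight j : col_weight H j = 4%N.
Proof.
rewrite /col_weight -(card_imset _ point_inj) -[RHS](card_ord 4).
rewrite -(card_imset _ (_ : injective (fun i => (i, coordinate phi i (block j)))));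
  last by move=> i k [].
apply: eq_card => x; apply/imsetP/imsetP => [[r]|[i _ ->]].
  rewrite inE entry_neq0 => /eqP e ->; exists (point r).1 => //.
  by rewrite e -surjective_pairing.
have /pointP[r rE] : ((i, coordinate phi i (block j)).1 == ord0) ==>
    ((i, coordinate phi i (block j)).2 \in V).
  by apply/implyP=> /= /eqP ->; apply/blockP; exists j.
by exists r; rewrite // inE entry_neq0 rE.
Qed.

(** A point [(0, u)] lies on the blocks [(u, c)] for all [c]; any other point lies
    on exactly one block [(v, c)] for each [v] in [V]. *)
Lemma incidence_row_weight r :
  row_weight H r = if (point r).1 == ord0 then #|G| else #|V|.
Proof.
rewrite /row_weight -(card_imset _ block_inj).
have -> : block @: [set j | H r j != 0] =
    [set p | (p.1 \in V) && (coordinate phi (point r).1 p == (point r).2)].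
  apply/setP=> p; rewrite inE; apply/imsetP/andP => [[j]|[/blockP[j <-] e]].
    rewrite inE entry_neq0 => e ->; split=> //; by apply/blockP; exists j.
  by exists j; rewrite // inE entry_neq0.
have rV : ((point r).1 == ord0) ==> ((point r).2 \in V) by apply/pointP; exists r.
case: (point r) rV => i u /=.
case: eqP => [->|/eqP n0] /= => [uV|_].
  rewrite -(card_imset (mem G) (_ : injective (pair u))); last by move=> c c' [].
  apply: eq_card => -[v c]; rewrite !inE /coordinate /=.
  apply/andP/imsetP => [[_ /eqP ->]|[c' _ [-> _]]]; by [exists c | rewrite eqxx].
pose s v : G := nth 0 [:: 0; 0; v; phi v] i.
have coordE v c : coordinate phi i (v, c) = c + s v.
  rewrite /coordinate /s; case: i n0 {s} => [[|[|[|[|i]]]] //= lt] _.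
  by rewrite addr0.
rewrite -(card_imset (mem V) (_ : injective (fun v => (v, u - s v)))); last first.
  by move=> v v' [].
apply: eq_card => -[v c]; rewrite !inE coordE /=.
apply/andP/imsetP => [[vV /eqP <-]|[v' vV [-> ->]]].
  by exists v; rewrite // addrK.
by rewrite subrK eqxx.
Qed.

Lemma sum_entries (X : {set 'I_n}) r :
  (\sum_(j in X) (H r j : nat))%N =
  #|fibre (block @: X) (coordinate phi) (point r).1 (point r).2|.
Proof.
have -> : fibre (block @: X) (coordinate phi) (point r).1 (point r).2 =
    block @: (X :&: [set j | H r j != 0]).
  apply/setP=> p; rewrite inE; apply/andP/imsetP => [[/imsetP[j jX ->] e]|[j]].
    by exists j; rewrite // !inE entry_neq0 jX.
  rewrite !inE entry_neq0 => /andP[jX e] ->; split=> //; exact: imset_f.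
rewrite card_imset // card_setI_sum; apply: eq_bigr => j _.
by rewrite inE entry_neq0 entry_nat.
Qed.

Hypotheses (V_ge2 : (1 < #|V|)%N) (G_ge2 : (1 < #|G|)%N).

Lemma incidence_stopping_distance :
  (forall x : G, x *+ 3 = 0 -> x = 0) ->
  (forall x y : G, x != 0 -> y != 0 -> x *+ 2 = 0 -> y *+ 2 = 0 -> x = y) ->
  {in V &, injective phi} -> {in V &, injective (fun x => phi x - x)} ->
  exists d, is_stopping_distance H d /\ (8 <= d)%N.
Proof.
move=> tors3 tors2 phiI difI.
have all_stop : stopping_set H [set: 'I_n].
  move=> r; right.
  have -> : (\sum_(j in [set: 'I_n]) (H r j : nat))%N = row_weight H r.
    rewrite /row_weight -(setTI [set j | _]) card_setI_sum; apply: eq_bigr => j _.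
    by rewrite inE entry_neq0 entry_nat.
  by rewrite incidence_row_weight; case: ifP.
have all_n0 : [set: 'I_n] != set0.
  by rewrite -card_gt0 cardsT card_ord incidence_cols; lia.
have [d dP] := stopping_distance_exists all_n0 all_stop.
exists d; split=> //; have [[X [X0 XS <-]] _] := dP.
rewrite -(card_imset X block_inj).
have SV p : p \in block @: X -> p.1 \in V.
  by case/imsetP=> j _ ->; apply/blockP; exists j.
apply: (card_ge8 (phi := phi)) => //.
- by move=> i j p q nij /SV pV /SV qV; apply: (coordinate_meet_once phiI difI nij).
- by have /set0Pn[j jX] := X0; apply/set0Pn; exists (block j); apply: imset_f.
move=> i p pX.
have /pointP[r rE] : ((i, coordinate phi i p).1 == ord0) ==> ((i, coordinate phi i p).2 \in V).
  by apply/implyP=> /= /eqP ->; apply: SV.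
have := XS r; rewrite /= sum_entries rE /=.
case=> // /eqP; rewrite cards_eq0 => /eqP/setP/(_ p).
by rewrite !inE pX eqxx.
Qed.

End Incidence.

(** * The cyclic group and its difference covering arrays *)

Lemma exists_unique_inj (I T : Type) (f : I -> T) :
  (forall x, exists! i, f i = x) -> injective f.
Proof.
by move=> bij v w e; have [u [_ uniq]] := bij (f v); rewrite -(uniq v) // -(uniq w).
Qed.

Section Cyclic.

Variable n : nat.
Local Notation G := 'I_n.+2.

Lemma submodE (x y : G) : submod x y = x - y.
Proof. by apply: val_inj; rewrite /= modnDmr. Qed.

Lemma torsion3_ord : ~~ (3 %| n.+2)%N -> forall x : G, x *+ 3 = 0 -> x = 0.
Proof.
move=> n3 x; rewrite Zp_mulrn => /(congr1 val) /= /eqP.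
rewrite -/(dvdn _ _) Gauss_dvdl; last by rewrite coprime_sym prime_coprime.
by move=> dvd; apply: val_inj => /=; rewrite -[LHS](modn_small (ltn_ord x)); apply/eqP.
Qed.

Lemma torsion2_ord (x y : G) :
  x != 0 -> y != 0 -> x *+ 2 = 0 -> y *+ 2 = 0 -> x = y.
Proof.
have half (z : G) : z != 0 -> z *+ 2 = 0 -> (z * 2 = n.+2)%N.
  rewrite -val_eqE /= -lt0n => z0; rewrite Zp_mulrn => /(congr1 val) /= /eqP.
  case/dvdnP=> q E; have := ltn_ord z; rewrite E.
  by case: q E => [|[|q]]; nia.
move=> x0 y0 x2 y2; apply: val_inj; have := half x x0 x2; have := half y y0 y2.
by rewrite /=; lia.
Qed.

Lemma sum_ord : ~~ odd n.+2 -> \sum_(x : G) x = - (n.+2 %/ 2)%:R.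
Proof.
move=> ev; rewrite (eq_bigr (fun x : G => (x : nat)%:R)); last first.
  by move=> x _; rewrite natr_Zp.
rewrite -natr_sum -(big_mkord xpredT id) bin2_sum bin2.
have E : (n.+2 = n.+2 %/ 2 * 2)%N by rewrite divnK // dvdn2.
apply/eqP; rewrite -addr_eq0 -natrD.
have -> : ((n.+2 * n.+2.-1)./2 + n.+2 %/ 2 = n.+2 %/ 2 * n.+2)%N.
  by rewrite {1}E mulnAC -divn2 mulnK //; nia.
by apply/eqP/val_inj; rewrite Zp_nat /= modnMl.
Qed.

(** The differences [delta v = D v 2 - v] take all [n.+1] nonzero values and add
    up to 0.  If [delta v = delta w] with [v], [w] distinct and other than [r0],
    then [delta] is a bijection from the indices other than [v] onto the nonzero
    elements.  These add up to minus [n.+2 / 2], so [delta v] is [n.+2 / 2], the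
    value at [r0]; thus [delta w = delta r0], against the injectivity of [delta]
    off [v]. *)
Lemma DCA_difference_inj (D : 'M[G]_(n.+2, 3)) (r0 : G) :
  is_DCA D -> standard_form D -> submod (D r0 2) (D r0 1) = (n.+2 %/ 2)%N :> nat ->
  {in [set~ r0] &, injective (fun v => D v 2 - v)}.
Proof.
move=> [ev _ bij cover] std half.
pose delta v := D v 2 - v.
have D2I : injective (fun v => D v 2) by apply/exists_unique_inj/bij.
have img : delta @: setT = [set~ 0].
  rewrite -[RHS](_ : [set d : G | (d : nat) != 0%N] = _); last first.
    by apply/setP=> d; rewrite !inE -val_eqE.
  rewrite -(cover 2 1) //; apply/setP=> d.
  by apply/imsetP/imsetP=> -[v _ ->]; exists v; rewrite // submodE std.
have sum0 : \sum_v delta v = 0.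
  by rewrite sumrB [X in _ - X](reindex_inj D2I) subrr.
move=> v w vr wr; rewrite -/(delta v) -/(delta w) => e.
apply/eqP; apply: contraT => nvw.
have imgv : delta @: [set~ v] = [set~ 0].
  rewrite -img; apply/eqP; rewrite eqEsubset imsetS ?subsetT //=.
  apply/subsetP=> _ /imsetP[x _ ->].
  have [->|nx] := eqVneq x v; last by rewrite imset_f // !inE.
  by rewrite e imset_f // !inE eq_sym.
have inj : {in [set~ v] &, injective delta}.
  by apply/imset_injP; rewrite imgv !cardsC1.
have deltav : delta v = delta r0.
  have -> : delta r0 = (n.+2 %/ 2)%:R.
    rewrite /delta -{2}(std r0) -submodE -half natr_Zp //.
  have := sum0; rewrite (bigD1 v) //= => /eqP; rewrite addr_eq0 => /eqP ->.
  have -> : \sum_(u | u != v) delta u = \sum_(x in [set~ 0 : G]) x.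
    by rewrite -imgv big_imset //; apply: eq_bigl => u; rewrite !inE.
  rewrite -[RHS]opprK -sum_ord // [in RHS](bigD1 0) //= add0r.
  by congr (- _); apply: eq_bigl => x; rewrite !inE.
rewrite !inE in vr wr; case/eqP: wr; apply: inj; rewrite ?inE 1?eq_sym //.
by rewrite -e.
Qed.

End Cyclic.

(** * The two parity-check matrices *)

Section ParityCheck.

Variables (n : nat).
Local Notation a := n.+2.
Local Notation G := 'I_n.+2.
Variable D : 'M[G]_(a, 3).
Hypothesis std : standard_form D.

Let phi (v : G) : G := D v 2.

Definition row_point (r : 'I_(a + (a + (a + a)))) : 'I_4 * G :=
  match split r with
  | inl u => (ord0, u)
  | inr r' => match split r' with
    | inl u => (@Ordinal 4 1 isT, u)
    | inr r'' => match split r'' with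
      | inl u => (@Ordinal 4 2 isT, u)
      | inr u => (@Ordinal 4 3 isT, u)
      end
    end
  end.

Definition point_row (x : 'I_4 * G) : 'I_(a + (a + (a + a))) :=
  nth (lshift _ x.2) [:: lshift _ x.2; rshift a (lshift _ x.2);
    rshift a (rshift a (lshift a x.2)); rshift a (rshift a (rshift a x.2))] x.1.

Lemma row_pointK : cancel row_point point_row.
Proof.
move=> r; rewrite /row_point; case: split_ordP => [u ->|r' ->] //.
case: split_ordP => [u ->|r'' ->] //.
by case: split_ordP => [u ->|u ->].
Qed.

Lemma point_rowK : cancel point_row row_point.
Proof.
have splitl p q (u : 'I_p) : split (lshift q u) = inl u by apply: (unsplitK (inl u)).
have splitr p q (u : 'I_q) : split (rshift p u) = inr u by apply: (unsplitK (inr u)).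
case=> [[[|[|[|[|k]]]] //= lt] u]; rewrite /point_row /row_point /= ?(splitl, splitr);
  by congr (_, _); apply: val_inj.
Qed.

Definition column_block (s : 'I_(\sum_(v < a) a)) : G * G :=
  (tagnat.sig1 s, tagnat.sig2 s).

Definition block_col (p : G * G) : 'I_(\sum_(v < a) a) :=
  tagnat.Rank (p_ := fun=> a) p.1 p.2.

Lemma column_blockK : cancel column_block block_col.
Proof. by move=> s; apply: tagnat.sig2K. Qed.

Lemma block_colK : cancel block_col column_block.
Proof.
case=> v c; rewrite /column_block /block_col /=; congr (_, _).
  exact: tagnat.Rank1K.
by apply: val_inj; rewrite tagnat.Rank2K.
Qed.

Lemma MmxE r s :
  Mmx D r s = (coordinate phi (row_point r).1 (column_block s) == (row_point r).2)%:R.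
Proof.
rewrite mxE /column_block /row_point /block_column.
set v := tagnat.sig1 s; set c : G := tagnat.sig2 s.
rewrite mxE; case: split_ordP => [u _|r' _]; first by rewrite mxE eq_sym.
rewrite mxE; case: split_ordP => [u _|r'' _]; first by rewrite mxE eq_sym.
rewrite mxE; case: split_ordP => [u _|u _].
  by rewrite mxE std submodE [c == _]eq_sym subr_eq [u == _]eq_sym.
by rewrite mxE submodE [c == _]eq_sym subr_eq [u == _]eq_sym.
Qed.

Hypothesis h3 : ~~ (3 %| a)%N.

Lemma construction1_regular_and_distance : is_DM D ->
  regular (construction1 D) (a ^ 2)%N 4 a /\
  exists d : nat, is_stopping_distance (construction1 D) d /\ (8 <= d)%N.
Proof.
move=> [_ _ bij cover].
have blockP p : reflect (exists s, column_block s = p) (p.1 \in [set: G]).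
  by rewrite inE; constructor; exists (block_col p); rewrite block_colK.
have pointP (x : 'I_4 * G) :
    reflect (exists r, row_point r = x) ((x.1 == ord0) ==> (x.2 \in [set: G])).
  by rewrite inE implybT; constructor; exists (point_row x); rewrite point_rowK.
have bI := can_inj column_blockK; have pI := can_inj row_pointK.
have cardG : #|[set: G]| = a by rewrite cardsT card_ord.
split; first split.
- by rewrite (incidence_cols bI blockP) cardG card_ord.
- by move=> s; apply: (incidence_col_weight pI blockP pointP MmxE).
- move=> r; rewrite (incidence_row_weight bI blockP pointP MmxE) cardG card_ord.
  by case: ifP.
apply: (incidence_stopping_distance bI blockP pointP MmxE).
- by rewrite cardG.
- by rewrite card_ord.
- exact: torsion3_ord.
- exact: torsion2_ord.
- by move=> v w _ _; apply: exists_unique_inj (bij 2 isT) v w.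
have inj : injective (fun v => submod (D v 2) (D v 1)).
  suff : {in [set: G] &, injective (fun v => submod (D v 2) (D v 1))}.
    by move=> inj v w; apply: inj; rewrite inE.
  apply/imset_injP/eqP; congr #|pred_of_set _|.
  rewrite -[RHS](cover 2 1) //; apply/setP=> d.
  by apply/imsetP/imsetP => -[v _ ->]; exists v.
by move=> v w _ _ e; apply: inj; rewrite !submodE !std.
Qed.

Lemma construction2_near_regular_and_distance (r0 : G) : (2 < a)%N -> is_DCA D ->
  submod (D r0 2) (D r0 1) = (a %/ 2)%N :> nat ->
  near_regular (construction2 D r0) (a ^ 2 - a)%N 4 [:: a.-1; a] /\
  exists d : nat, is_stopping_distance (construction2 D r0) d /\ (8 <= d)%N.
Proof.
move=> a_gt2 DCA half; have [_ _ bij _] := DCA.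
(* The deleted row is the point (0, r0), and the deleted columns are the blocks
   on it. *)
pose del : 'I_(a + (a + (a + a))) := lshift (a + (a + a)) r0.
pose point (r : 'I_(a + (a + (a + a))).-1) := row_point (lift del r).
pose col (s : 'I_(\sum_(k < a.-1) a)) : 'I_(\sum_(v < a) a) :=
  block_col (lift r0 (tagnat.sig1 s), tagnat.sig2 s).
pose block s := column_block (col s).
have entryE r s : construction2 D r0 r s
    = (coordinate phi (point r).1 (block s) == (point r).2)%:R.
  by rewrite -MmxE !mxE.
have delE : row_point del = (ord0, r0).
  by rewrite -[del]/(point_row (ord0, r0)) point_rowK.
have bI : injective block.
  apply: (inj_comp (can_inj column_blockK)) => s t /(can_inj block_colK) e.
  have /lift_inj e1 := congr1 fst e; have /= e2 := congr1 snd e.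
  rewrite -[s]tagnat.sig2K -[t]tagnat.sig2K; apply: val_inj; apply/eqP.
  by rewrite tagnat.eq_Rank e1 e2 !eqxx.
have pI : injective point.
  by apply: (inj_comp (can_inj row_pointK)); apply: lift_inj.
have blockP p : reflect (exists s, block s = p) (p.1 \in [set~ r0]).
  rewrite !inE; apply: (iffP idP) => [np|[s <-]]; last first.
    by rewrite /block /col block_colK /= eq_sym neq_lift.
  case: (unliftP r0 p.1) np => [k pk _|->]; last by rewrite eqxx.
  exists (tagnat.Rank (p_ := fun=> a) k p.2).
  rewrite /block /col block_colK tagnat.Rank1K -pk [RHS]surjective_pairing.
  by congr (_, _); apply: val_inj; rewrite tagnat.Rank2K.
have pointP (x : 'I_4 * G) :
    reflect (exists r, point r = x) ((x.1 == ord0) ==> (x.2 \in [set~ r0])).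
  rewrite !inE; apply: (iffP idP) => [nx|[r <-]].
    case: (unliftP del (point_row x)) => [r E|E].
      by exists r; rewrite /point -E point_rowK.
    by move: nx; rewrite -(point_rowK x) E delE !eqxx.
  apply/implyP=> /eqP e1; apply/eqP=> e2; have := neq_lift del r.
  case/eqP; apply: (can_inj row_pointK); rewrite delE -/(point r).
  by rewrite (surjective_pairing (point r)) e1 e2.
have cardV : #|[set~ r0]| = n.+1 by rewrite cardsC1 card_ord.
split; first split.
- by rewrite (incidence_cols bI blockP) cardV card_ord; lia.
- by move=> s; apply: (incidence_col_weight pI blockP pointP entryE).
- move=> r; rewrite (incidence_row_weight bI blockP pointP entryE) cardV card_ord.
  by case: ifP; rewrite !inE eqxx ?orbT.
apply: (incidence_stopping_distance bI blockP pointP entryE).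
- by rewrite cardV.
- by rewrite card_ord.
- exact: torsion3_ord.
- exact: torsion2_ord.
- by move=> v w _ _; apply: exists_unique_inj (bij 2 isT) v w.
exact: DCA_difference_inj.
Qed.

End ParityCheck.

Theorem lemma9 (a : nat) (h3 : ~~ (3 %| a)%N) :
  ((3 <= a)%N -> odd a ->
   forall D : 'M['I_a]_(a, 3), is_DM D -> standard_form D ->
     regular (construction1 D) (a ^ 2)%N 4 a /\
     exists d : nat, is_stopping_distance (construction1 D) d /\ (8 <= d)%N)
  /\
  ((4 <= a)%N -> ~~ odd a ->
   forall D : 'M['I_a]_(a, 3), is_DCA D -> standard_form D ->
   forall r0 : 'I_a, submod (D r0 2) (D r0 1) = (a %/ 2)%N :> nat ->
     near_regular (construction2 D r0) (a ^ 2 - a)%N 4 [:: a.-1; a] /\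
     exists d : nat, is_stopping_distance (construction2 D r0) d /\ (8 <= d)%N).
Proof.
case: a h3 => [|[|n]] // h3; split=> [_ _ D DM std | a_ge4 _ D DCA std r0 half].
  exact: construction1_regular_and_distance.
by apply: construction2_near_regular_and_distance => //; apply: ltnW.
Qed.
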